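(* Let $\Gamma=(V,E)$ be a finite unoriented graph without loops and multiple edges, and for each $v\in V$ let $G_v$ be a group with the centroid property. Then the graph product $\prod_\Gamma G_v$ has the centroid property.
   Context: Graph product: $\prod_\Gamma G_v$ is the quotient of the free product of the groups $G_v$, $v\in V$, by the normal subgroup generated by all commutators $[g_1,g_2]$ with $g_1\in G_{v_1}$, $g_2\in G_{v_2}$, $(v_1,v_2)\in E$. All polynomials are assumed to have non-negative coefficients. Centroid property: a countable group $G$ satisfies the centroid property if there exist an action of $G$ by isometries on a metric space $(X,\mathrm{dist})$ with point stabilizers finite of uniformly bounded sizes, a point $x_0\in X$, a map $\mathfrak{c}\colon G\times G\to X$ and a polynomial $P$ such that, with $L(g)=\mathrm{dist}(x_0,g\cdot x_0)$: ($c_1$) for every $k\in G$ and every $r>0$, the set $\{\mathfrak{c}(g,k): g\in G,\ L(g)\le r\}$ has at most $P(r)$ elements; ($c_2$) for every $g\in G$, the set $\{\mathfrak{c}(g,k): k\in G\}$ has at most $P(L(g))$ elements; ($c_3$) for every $h\in G$ and every $r>0$, the set $\{g^{-1}\cdot\mathfrak{c}(g,gh): g\in G,\ L(g)\le r\}$ has at most $P(r)$ elements. *)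

(* Defs.v *)
From HB Require Import structures.
From mathcomp Require Import all_boot all_order all_algebra.
From mathcomp Require Import generic_quotient.
From mathcomp Require Import boolp classical_sets functions cardinality reals.
From mathcomp Require Import topology.

Set Implicit Arguments.
Unset Strict Implicit.
Unset Printing Implicit Defensive.

Import Order.TTheory GRing.Theory Num.Theory.

Local Open Scope quotient_scope.
Local Open Scope classical_set_scope.
Local Open Scope group_scope.

Section FreeProduct.
Variables (V : choiceType) (G : V -> groupType).

Local Notation word := (seq {v : V & G v}).

Definition letter (v : V) (g : G v) : {v : V & G v} := Tagged G g.

Inductive word_eq : word -> word -> Prop :=
| word_eq_refl w : word_eq w w
| word_eq_sym w1 w2 : word_eq w1 w2 -> word_eq w2 w1
| word_eq_trans w1 w2 w3 : word_eq w1 w2 -> word_eq w2 w3 -> word_eq w1 w3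
| word_eq_cat w1 w2 w3 w4 :
    word_eq w1 w2 -> word_eq w3 w4 -> word_eq (w1 ++ w3) (w2 ++ w4)
| word_eq_one v : word_eq [:: letter (1 : G v)] [::]
| word_eq_mul v (g h : G v) :
    word_eq [:: letter g; letter h] [:: letter (g * h)].

Lemma word_eqb_equiv : equiv_class_of (fun w1 w2 => `[< word_eq w1 w2 >]).
Proof.
split=> [w|w1 w2|w2 w1 w3].
- exact/asboolP/word_eq_refl.
- by apply/asboolP/asboolP => /word_eq_sym.
- by move=> /asboolP h1 /asboolP h2; apply/asboolP/(word_eq_trans h1 h2).
Qed.

Canonical word_eqb := EquivRelPack word_eqb_equiv.

Definition free_product : Type := {eq_quot word_eqb}.

HB.instance Definition _ := Choice.on free_product.
HB.instance Definition _ := EqQuotient.on free_product.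

Implicit Types (w : word) (x y : free_product).

Definition word_inv w : word :=
  rev (map (fun l : {v : V & G v} => letter (tagged l : G (tag l))^-1) w).

Definition fp_of_word w : free_product := \pi_free_product w.

Lemma fp_of_wordP w1 w2 : fp_of_word w1 = fp_of_word w2 <-> word_eq w1 w2.
Proof.
split=> [/eqmodP/asboolP//|h]; apply/eqmodP; exact/asboolP.
Qed.

Lemma repr_fp w : word_eq (repr (fp_of_word w)) w.
Proof. by apply/fp_of_wordP; rewrite /fp_of_word reprK. Qed.

Lemma word_inv_eq w1 w2 :
  word_eq w1 w2 -> word_eq (word_inv w1) (word_inv w2).
Proof.
elim=> {w1 w2} [w|w1 w2 _|w1 w2 w3 _ h1 _|w1 w2 w3 w4 _ h1 _ h2|v|v g h].
- exact: word_eq_refl.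
- exact: word_eq_sym.
- exact: word_eq_trans.
- by rewrite /word_inv !map_cat !rev_cat; apply: word_eq_cat.
- by rewrite /word_inv /= invg1; apply: word_eq_one.
- by rewrite /word_inv /= invgM; apply: word_eq_mul.
Qed.

Lemma word_Vmul w : word_eq (word_inv w ++ w) [::].
Proof.
elim: w => [|[v g] w ih]; first exact: word_eq_refl.
rewrite /word_inv /= rev_cons -cats1 -catA /=.
apply: word_eq_trans ih; apply: word_eq_cat; first exact: word_eq_refl.
rewrite -[X in word_eq _ X]cat0s.
apply: (@word_eq_cat [:: letter g^-1; letter g] _ w); last exact: word_eq_refl.
by apply: word_eq_trans (word_eq_mul _ _) _; rewrite mulVg; apply: word_eq_one.
Qed.

Lemma word_mulV w : word_eq (w ++ word_inv w) [::].
Proof.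
have -> : w = word_inv (word_inv w).
  rewrite /word_inv map_rev revK -map_comp -[LHS]map_id.
  by apply: eq_map => -[v g] /=; rewrite /letter /= invgK.
set w' := word_inv w.
suff -> : word_inv (word_inv w') = w' by exact: word_Vmul.
rewrite /word_inv map_rev revK -map_comp -[RHS]map_id.
by apply: eq_map => -[v g] /=; rewrite /letter /= invgK.
Qed.

Definition fp_one : free_product := fp_of_word [::].
Definition fp_mul x y : free_product := fp_of_word (repr x ++ repr y).
Definition fp_inv x : free_product := fp_of_word (word_inv (repr x)).

Lemma fp_ind (P : free_product -> Prop) :
  (forall w, P (fp_of_word w)) -> forall x, P x.
Proof. by move=> h x; rewrite -[x]reprK; apply: h. Qed.

Lemma fp_mulE w1 w2 :
  fp_mul (fp_of_word w1) (fp_of_word w2) = fp_of_word (w1 ++ w2).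
Proof. by apply/fp_of_wordP/word_eq_cat; apply: repr_fp. Qed.

Lemma fp_invE w : fp_inv (fp_of_word w) = fp_of_word (word_inv w).
Proof. exact/fp_of_wordP/word_inv_eq/repr_fp. Qed.

Lemma fp_mulA : associative fp_mul.
Proof.
elim/fp_ind => w1; elim/fp_ind => w2; elim/fp_ind => w3.
by rewrite !fp_mulE catA.
Qed.

Lemma fp_1mul : left_id fp_one fp_mul.
Proof. by elim/fp_ind => w; rewrite fp_mulE. Qed.

Lemma fp_mul1 : right_id fp_one fp_mul.
Proof. by elim/fp_ind => w; rewrite fp_mulE cats0. Qed.

Lemma fp_Vmul : left_inverse fp_one fp_inv fp_mul.
Proof.
elim/fp_ind => w; rewrite fp_invE fp_mulE; exact/fp_of_wordP/word_Vmul.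
Qed.

Lemma fp_mulV : right_inverse fp_one fp_inv fp_mul.
Proof.
elim/fp_ind => w; rewrite fp_invE fp_mulE; exact/fp_of_wordP/word_mulV.
Qed.

HB.instance Definition _ := isGroup.Build free_product
  fp_mulA fp_1mul fp_mul1 fp_Vmul fp_mulV.

Definition fp_inj (v : V) (g : G v) : free_product := fp_of_word [:: letter g].

Lemma fp_injM v : {morph @fp_inj v : g h / g * h}.
Proof.
move=> g h; rewrite -[RHS]/(fp_mul _ _) fp_mulE.
exact/fp_of_wordP/word_eq_sym/word_eq_mul.
Qed.

Lemma free_product_universal (H : groupType)
    (f : forall v, G v -> H) (fM : forall v, {morph f v : g h / g * h}) :
  exists! phi : free_product -> H,
    {morph phi : x y / x * y} /\ forall v (g : G v), phi (fp_inj g) = f v g.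
Proof.
have f1 v : f v 1 = 1 by apply: (@mulgI _ (f v 1)); rewrite -fM !mulg1.
pose ev w : H := foldr (fun l a => f (tag l) (tagged l) * a) 1 w.
have ev_cat w1 w2 : ev (w1 ++ w2) = ev w1 * ev w2.
  by elim: w1 => [|l w1 ih] /=; rewrite ?mul1g // ih mulgA.
have evP w1 w2 : word_eq w1 w2 -> ev w1 = ev w2.
  elim=> {w1 w2} [//|//|w1 w2 w3 _ -> _ ->//|w1 w2 w3 w4 _ h1 _ h2|v|v g h].
  - by rewrite !ev_cat h1 h2.
  - by rewrite /= f1 mulg1.
  - by rewrite /= fM !mulg1.
exists (fun x => ev (repr x)); split; first split.
- elim/fp_ind => w1; elim/fp_ind => w2.
  rewrite -[_ * _]/(fp_mul _ _) fp_mulE.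
  by rewrite (evP _ _ (repr_fp w1)) (evP _ _ (repr_fp w2)) (evP _ _ (repr_fp _)).
- by move=> v g; rewrite (evP _ _ (repr_fp _)) /= mulg1.
move=> phi [phiM phif]; apply/funext; elim/fp_ind => w.
rewrite (evP _ _ (repr_fp w)); elim: w => [|[v g] w ih] /=.
  by apply: (@mulgI _ (phi 1)); rewrite -[fp_of_word _]/(1 : free_product) -phiM !mulg1.
rewrite ih -phif -phiM; congr phi.
by rewrite -[_ * _]/(fp_mul _ _) fp_mulE.
Qed.

End FreeProduct.

Section QuotientByNormalClosure.
Variables (F : groupType) (S : set F).

Definition normal_subgroup (N : set F) : Prop :=
  [/\ N 1, forall x y, N x -> N y -> N (x * y),
      forall x, N x -> N x^-1 & forall x y, N x -> N (x ^ y)].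

Definition normal_closure : set F := smallest normal_subgroup S.

Lemma normal_closureP : normal_subgroup normal_closure.
Proof.
split=> [|x y hx hy|x hx|x y hx] N [nN sSN]; have [N1 NM NV NJ] := nN.
- exact: N1.
- by apply: NM; [apply: hx|apply: hy].
- by apply: NV; apply: hx.
- by apply: NJ; apply: hx.
Qed.

Lemma sub_normal_closure : S `<=` normal_closure.
Proof. by move=> x Sx N [_]; apply. Qed.

Definition cosetb : rel F := fun x y => `[< normal_closure (x^-1 * y) >].

Lemma cosetb_equiv : equiv_class_of cosetb.
Proof.
have [N1 NM NV NJ] := normal_closureP.
split=> [x|x y|y x z].
- by apply/asboolP; rewrite mulVg.
- by apply/asboolP/asboolP => /NV; rewrite invgM invgK.
- move=> /asboolP h1 /asboolP h2; apply/asboolP.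
  by have := NM _ _ h1 h2; rewrite mulgA mulgK.
Qed.

Canonical coset_equiv := EquivRelPack cosetb_equiv.

Definition quot_group : Type := {eq_quot coset_equiv}.

HB.instance Definition _ := Choice.on quot_group.
HB.instance Definition _ := EqQuotient.on quot_group.

Definition quot_pi (x : F) : quot_group := \pi_quot_group x.

Lemma quot_piP x y : quot_pi x = quot_pi y <-> normal_closure (x^-1 * y).
Proof.
split=> [/eqmodP/asboolP//|h]; apply/eqmodP; exact/asboolP.
Qed.

Definition quot_mul (a b : quot_group) := quot_pi (repr a * repr b).
Definition quot_inv (a : quot_group) := quot_pi (repr a)^-1.

Lemma repr_quot x : normal_closure ((repr (quot_pi x))^-1 * x).
Proof. by apply/quot_piP; rewrite /quot_pi reprK. Qed.

Lemma quot_ind (P : quot_group -> Prop) :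
  (forall x, P (quot_pi x)) -> forall a, P a.
Proof. by move=> h a; rewrite -[a]reprK; apply: h. Qed.

Lemma quot_mulE x y : quot_mul (quot_pi x) (quot_pi y) = quot_pi (x * y).
Proof.
have [N1 NM NV NJ] := normal_closureP.
apply/quot_piP; set a := repr _; set b := repr _.
have ha : normal_closure (a^-1 * x) := repr_quot x.
have hb : normal_closure (b^-1 * y) := repr_quot y.
have := NM _ _ (NJ _ b ha) hb.
by rewrite /conjg !mulgA mulgK invgM.
Qed.

Lemma quot_invE x : quot_inv (quot_pi x) = quot_pi x^-1.
Proof.
have [N1 NM NV NJ] := normal_closureP.
apply/quot_piP; have := NV _ (NJ _ x^-1 (repr_quot x)).
by rewrite /conjg !invgK !mulgA mulgK !invgM !invgK.
Qed.

Lemma quot_mulA : associative quot_mul.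
Proof.
elim/quot_ind => x; elim/quot_ind => y; elim/quot_ind => z.
by rewrite !quot_mulE mulgA.
Qed.

Lemma quot_1mul : left_id (quot_pi 1) quot_mul.
Proof. by elim/quot_ind => x; rewrite quot_mulE mul1g. Qed.

Lemma quot_mul1 : right_id (quot_pi 1) quot_mul.
Proof. by elim/quot_ind => x; rewrite quot_mulE mulg1. Qed.

Lemma quot_Vmul : left_inverse (quot_pi 1) quot_inv quot_mul.
Proof. by elim/quot_ind => x; rewrite quot_invE quot_mulE mulVg. Qed.

Lemma quot_mulV : right_inverse (quot_pi 1) quot_inv quot_mul.
Proof. by elim/quot_ind => x; rewrite quot_invE quot_mulE mulgV. Qed.

HB.instance Definition _ := isGroup.Build quot_group
  quot_mulA quot_1mul quot_mul1 quot_Vmul quot_mulV.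

Lemma quot_piM : {morph quot_pi : x y / x * y}.
Proof. by move=> x y; rewrite -[RHS]/(quot_mul _ _) quot_mulE. Qed.

End QuotientByNormalClosure.

Section GraphProduct.
Variables (V : choiceType) (e : rel V) (G : V -> groupType).

Definition edge_commutators : set (free_product G) :=
  [set x | exists v1 v2 (g1 : G v1) (g2 : G v2),
     e v1 v2 /\ x = [~ fp_inj g1, fp_inj g2]].

Definition graph_product : groupType := quot_group edge_commutators.

End GraphProduct.

Section Centroid.
Variable R : realType.
Local Open Scope ring_scope.

Definition card_at_most (T : Type) (A : set T) (b : R) : Prop :=
  exists2 n : nat, (A #<= `I_n)%card & n%:R <= b.

Definition isometric_action (G : groupType) (X : metricType R)
    (act : G -> X -> X) : Prop :=
  [/\ forall x, act 1%g x = x,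
      forall g h x, act (g * h)%g x = act g (act h x) &
      forall g x y, mdist (act g x) (act g y) = mdist x y].

Definition stabilizer (G : groupType) (X : Type) (act : G -> X -> X) (x : X) :
  set G := [set g | act g x = x].

Definition centroid_property (G : groupType) : Prop :=
  countable [set: G] /\
  exists (X : metricType R) (act : G -> X -> X) (x0 : X) (c : G -> G -> X)
         (P : {poly R}),
    let L (g : G) := mdist x0 (act g x0) in
    isometric_action act /\
    (exists N : nat, forall x, (stabilizer act x #<= `I_N)%card) /\
    P \is a polyOver Num.nneg /\
    [/\ forall (k : G) (r : R), 0 < r ->
          card_at_most [set c g k | g in [set g | L g <= r]] P.[r],
        forall g : G,
          card_at_most [set c g k | k in [set: G]] P.[L g] &
        forall (h : G) (r : R), 0 < r ->
          card_at_most [set act g^-1%g (c g (g * h)%g) | g in [set g | L g <= r]]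
            P.[r]].

End Centroid.

(* Main.v *)
From HB Require Import structures.
Require Import Defs.
From mathcomp Require Import all_boot all_order all_algebra.
From mathcomp Require Import generic_quotient.
From mathcomp Require Import boolp classical_sets functions cardinality reals.
From mathcomp Require Import topology.
From mathcomp Require Import zify.

(** The centroid property only depends on a length and on a map from pairs of
group elements to group elements. Since stabilizers are uniformly finite, a
centroid map into a metric space lifts, through a choice of orbit
representatives, to a map into the group itself, at the cost of a bounded
factor in the last counting condition; rounding displacements up then gives a
length with natural values ([centroid_of_property]). Conversely, a length turns
the group into a metric space on which it acts freely by left translations
([property_of_centroid]). So it is enough to combine natural-valued lengths
[L v] and centroid maps [c v] of the vertex groups.

Every element of the graph product has a reduced word, unique up to exchanging
consecutive letters of adjacent vertices. What is used of it is the head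
[hd v g] of [g] at each vertex [v]: the letter of the group at [v] that can be
moved to the front, or 1. Heads are constructed from an action on pilings; they
determine which products are reduced, the nontrivial heads of an element lie
at the vertices of a clique, and a prefix of [k] is determined by its number of
letters at each vertex ([prefix_uniq]), so that [k] has at most (r+1)^|V|
prefixes of length at most [r]. The length of a product is the sum of the
lengths of the letters of a reduced word.

Given [g] and [k], let [x] be a maximal common prefix, [g = x g'] and
[k = x k'], and let [S] be the clique of the vertices where both [g'] and [k']
have a nontrivial head. Writing [p] and [q] for the products over [S] of the
heads of [g'] and of [k'], one has [g' = p y] and [k' = q z], and
[g^-1 k = y^-1 (p^-1 q) z] is again reduced: geodesic triangles of the graph
product are tripods around a triangle in the direct product of the vertex groups
of a clique. The center of the triangle 1, [g], [k] is [x] times the product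
over [S] of the centroids [c v (p v) (q v)].

The three counting conditions then have the same proof. If [k] is fixed and [g]
is short, [x] is a short prefix of [k], the [q v] are read off [k] and [x], and
the first condition in the vertex groups bounds the number of
[c v (p v) (q v)]; if [g] is fixed, so are the possible [x] and [p v]; and if
[h = g^-1 k] is fixed, [g^-1] times the center is [y^-1] times the product of the
[(p v)^-1 c v (p v) (q v)], where [y^-1] is a short prefix of [h] after which [h]
reads the letters [(p v)^-1 q v]. Lemma [covered_prefixes] is the common count.
*)

Set Implicit Arguments.
Unset Strict Implicit.
Unset Printing Implicit Defensive.

Import Order.TTheory GRing.Theory Num.Theory.

Local Open Scope group_scope.

(** * Bounding cardinalities by enumerations *)

Lemma exists_fun (X Y : Type) (P : X -> Y -> Prop) :
  (forall x, exists y, P x y) -> exists f, forall x, P x (f x).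
Proof. by move=> /boolp.choice[f fP]; exists f. Qed.

(** Cardinal bounds are only ever composed and compared here, so they are carried
by enumerations, which compose by composing functions; the index set [P]
avoids naming the image of [P] under [f]. *)
Definition covered (I T : Type) (P : I -> Prop) (f : I -> T) (b : nat) :=
  exists F : nat -> T, forall i, P i -> exists2 n, n < b & F n = f i.

Lemma covered_le (I T : Type) (P : I -> Prop) (f : I -> T) b b' :
  b <= b' -> covered P f b -> covered P f b'.
Proof.
move=> le_b [F HF]; exists F => i /HF[n ltn Fn].
by exists n => //; apply: leq_trans ltn le_b.
Qed.

Lemma covered_fin (I T : Type) (P : I -> Prop) (f : I -> T) (J : finType)
    (F : J -> T) (t0 : T) :
  (forall i, P i -> exists j, F j = f i) -> covered P f #|J|.
Proof.
move=> HF; exists (fun n => nth t0 (map F (enum J)) n) => i /HF[j <-].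
exists (enum_rank j); first exact: ltn_ord.
by rewrite (nth_map j) ?nth_enum_rank // -cardE ltn_ord.
Qed.

(** If [h i] is one of [n] values depending only on [f i], then the pairs
(number of [f i], number of [h i] among these) are encoded in base [n]. *)
Lemma covered_pair (I T U : Type) (P : I -> Prop) (f : I -> T) (h : I -> U)
    (E : T -> nat -> U) m n : covered P f m ->
  (forall i, P i -> exists2 j, j < n & E (f i) j = h i) -> covered P h (m * n).
Proof.
move=> [F FP] EP; exists (fun k => E (F (k %/ n)%N) (k %% n)%N) => i Pi.
have [k ltk Fk] := FP i Pi; have [j ltj Ej] := EP i Pi.
have n_gt0 : 0 < n by apply: leq_ltn_trans ltj.
exists (k * n + j)%N; first by nia.
by rewrite divnMDl // divn_small // addn0 Fk modnMDl modn_small.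
Qed.

Section CardinalBounds.
Local Open Scope classical_set_scope.
Local Open Scope card_scope.

Lemma covered_of_card (I T : Type) (P : set I) (f : I -> T) (t0 : T) n :
  f @` P #<= `I_n -> covered P f n.
Proof.
move=> /pcard_leP[h]; have h_inj := 'inj_h; have h_fun := 'funS_h.
have /boolp.choice[F FP] k : exists t, forall i, P i -> h (f i) = k -> t = f i.
  have [[i [Pi hi]]|no_i] := pselect (exists i, P i /\ h (f i) = k); last first.
    by exists t0 => i Pi hi; case: no_i; exists i.
  exists (f i) => j Pj hj; apply: h_inj (etrans hi (esym hj)).
    by rewrite inE; exists i.
  by rewrite inE; exists j.
exists F => i Pi; exists (h (f i)); last exact: FP.
by apply: h_fun; exists i.
Qed.

Lemma card_of_covered (I T : Type) (P : set I) (f : I -> T) n :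
  covered P f n -> f @` P #<= `I_n.
Proof.
move=> [F FP]; apply: card_le_trans (card_image_le F `I_n).
by apply: subset_card_le => _ [i /FP[k ltk Fk] <-]; exists k.
Qed.

End CardinalBounds.

(** A single exponent stands for a polynomial bound: any constant factor is absorbed
because the base is at least 2, and bounds compare by comparing exponents. *)
Definition rate (d r : nat) : nat := (r.+2 ^ d)%N.

Lemma rate_le d d' r r' : d <= d' -> r <= r' -> rate d r <= rate d' r'.
Proof.
move=> le_d le_r; apply: (@leq_trans (rate d' r)); first by rewrite leq_pexp2l.
by rewrite /rate; case: d' {le_d} => // d'; rewrite leq_exp2r.
Qed.

Lemma rate_gt0 d' r : 0 < rate d' r.
Proof. by rewrite expn_gt0. Qed.

(** * Centroids with respect to a natural-valued length *)

Definition is_length (H : groupType) (L : H -> nat) : Prop :=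
  [/\ L 1 = 0, forall x, L x = 0 -> x = 1, forall x, L x^-1 = L x
    & forall x y, L (x * y) <= L x + L y].

(** The centroid property with the group acting on itself by left translations. In
the terms of the triangle with vertices 1, [g] and [k], two of the vertices
are fixed in each condition while the remaining one varies: the third vertex
if the short side is fixed, and an end of the short side otherwise (up to
translation by [g^-1] for the last condition). *)
Record is_centroid (H : groupType) (L : H -> nat) (c : H -> H -> H) (d : nat)
    : Prop := IsCentroid {
  centers_fixed_target : forall k r, covered (fun g => L g <= r) (c^~ k) (rate d r);
  centers_fixed_source : forall g, covered (fun=> True) (c g) (rate d (L g));
  centers_fixed_quotient : forall h r,
    covered (fun g => L g <= r) (fun g => g^-1 * c g (g * h)) (rate d r) }.

Lemma is_centroid_le (H : groupType) (L : H -> nat) c d d' :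
  d <= d' -> is_centroid L c d -> is_centroid L c d'.
Proof.
move=> le_d [H1 H2 H3]; split=> *; apply: covered_le (rate_le le_d (leqnn _)) _.
- exact: H1.
- exact: H2.
- exact: H3.
Qed.

Section FromMetric.
Variable R : realType.
Local Open Scope ring_scope.

Lemma horner_le (P : {poly R}) x y : P \is a polyOver Num.nneg ->
  0 <= x -> x <= y -> P.[x] <= P.[y].
Proof.
move=> P_nneg x0 le_xy; rewrite !horner_coef ler_sum // => i _.
apply: ler_wpM2l; first by have /polyOverP/(_ i) := P_nneg; rewrite nnegrE.
by apply: lerXn2r; rewrite ?nnegrE ?(le_trans x0).
Qed.

(** For arguments at least 1, a polynomial with nonnegative coefficients is at most
the sum of its coefficients times the power by its size. *)
Lemma poly_rate (P : {poly R}) N : P \is a polyOver Num.nneg ->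
  exists d, forall n m : nat, m%:R <= P.[n.+1%:R] -> (m * N <= rate d n)%N.
Proof.
move=> P_nneg; pose S := \sum_(i < size P) P`_i; pose K := (Num.truncn S).+1.
exists (K * N + size P)%N => n m le_m.
have le_mK : (m <= K * n.+1 ^ size P)%N.
  rewrite -(ler_nat R); apply: le_trans le_m _.
  rewrite natrM natrX horner_coef; apply: (@le_trans _ _ (S * n.+1%:R ^+ size P)).
    rewrite /S mulr_suml ler_sum // => i _; apply: ler_wpM2l.
      by have /polyOverP/(_ i) := P_nneg; rewrite nnegrE.
    by apply: ler_weXn2l; rewrite ?ler1n // ltnW.
  by apply: ler_wpM2r; rewrite ?exprn_ge0 // ltW // truncnS_gt.
apply: leq_trans (leq_mul le_mK (leqnn N)) _; rewrite mulnAC /rate expnD.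
apply: leq_mul.
  apply: (@leq_trans (2 ^ (K * N))%N); first exact/ltnW/ltn_expl.
  by case: (K * N)%N => // k; rewrite leq_exp2r.
by case: (size P) => // k; rewrite leq_exp2r.
Qed.

(** The centroid map is lifted to the group through a section [s] of the orbit maps:
[s x] moves the representative [o x] of the orbit of [x] to [x]. The lift is not
equivariant, but [g^-1 * s y] and [s (g^-1 y)] differ on the right by an element
of the stabilizer of [o y], for which there are at most [N] possibilities. *)
Lemma centroid_of_property (G : groupType) : centroid_property R G ->
  exists (L : G -> nat) c d, is_length L /\ is_centroid L c d.
Proof.
move=> [_ [X [act [x0 [c [P]]]]]].
set L0 := fun g => _ => -[[act1 actM act_iso] [[N stabN] [P_nneg [H1 H2 H3]]]].
have L0V g : L0 g^-1%g = L0 g.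
  by rewrite /L0 -(act_iso g) -actM mulgV act1 metric_sym.
have L0M g h : L0 (g * h)%g <= L0 g + L0 h.
  apply: le_trans (metric_triangle _ (act g x0) _) _.
  by rewrite lerD2l actM act_iso.
have L0_ge0 g : 0 <= L0 g by exact: mdist_ge0.
have L01 : L0 1%g = 0 by rewrite /L0 act1 mdistxx.
(* Truncation plus 1 is subadditive, and positive away from 1, whereas a
   displacement vanishes on the stabilizer of x0. *)
pose L g : nat := if g == 1%g then 0%N else (Num.truncn (L0 g)).+1.
have L0_le g r : (L g <= r)%N -> L0 g <= r.+1%:R.
  rewrite /L; case: eqP => [->|_]; first by rewrite L01.
  move=> le_r; apply: le_trans (ltW (truncnS_gt _)) _.
  by rewrite ler_nat ltnW.
have L_len : is_length L.
  split=> [|g|g|g h].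
  - by rewrite /L eqxx.
  - by rewrite /L; case: eqP.
  - by rewrite /L invg_eq1 L0V.
  rewrite /L; have [->|g1] := eqVneq g 1%g; first by rewrite mul1g.
  have [->|h1] := eqVneq h 1%g; first by rewrite mulg1 (negPf g1) addn0.
  case: eqP => // _; rewrite addnS ltnS truncn_le_nat.
  apply: le_lt_trans (L0M g h) _; rewrite -addnS natrD.
  by rewrite ltrD ?truncnS_gt.
have [stab stabP] : exists st : X -> nat -> G, forall x g, act g x = x ->
    exists2 j, (j < N)%N & st x j = g.
  apply: (@exists_fun _ _ (fun x (st : nat -> G) => forall g, act g x = x ->
    exists2 j, (j < N)%N & st j = g)) => x.
  have := stabN x; rewrite -[stabilizer act x]image_id.
  by move=> /(covered_of_card 1%g).
pose o x : X := xget x0 [set y | exists g, act g y = x].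
have /exists_fun[s sP] x : exists g, act g (o x) = x.
  rewrite /o; case: xgetP => // /(_ x)[]; exists 1%g; exact: act1.
have sV x : act (s x)^-1%g x = o x by rewrite -{2}(sP x) -actM mulVg act1.
have oP g x : o (act g x) = o x.
  rewrite /o; congr xget; apply/seteqP; split=> y [h hy].
    by exists (g^-1 * h)%g; rewrite actM hy -actM mulVg act1.
  by exists (g * h)%g; rewrite actM hy.
(* The factor N.+1 is for the stabilizers; it is positive, so that the bound also
   dominates the polynomial itself in the first two conditions. *)
have [d dP] := poly_rate N.+1 P_nneg.
have mul_leq m n : (m * N.+1 <= n -> m <= n)%N by nia.
exists L, (fun g k => s (c g k)), d; split=> //; split=> [k r|g|h r].
- have [|n cn ln] := H1 k r.+1%:R; first by rewrite ltr0n.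
  apply: covered_le (mul_leq _ _ (dP _ _ ln)) _.
  have [F FP] := covered_of_card x0 cn; exists (s \o F) => g /L0_le Lg.
  by have [j ltj <-] := FP g Lg; exists j.
- have [n cn ln] := H2 g.
  apply: (@covered_le _ _ _ _ n).
    apply/mul_leq/dP; apply: le_trans ln _.
    (* The shift by one between the two lengths is the one in poly_rate. *)
    exact: horner_le (L0_ge0 g) (L0_le _ _ (leqnn _)).
  have [F FP] := covered_of_card x0 cn; exists (s \o F) => k _.
  by have [//|j ltj <-] := FP k; exists j.
have [|n cn ln] := H3 h r.+1%:R; first by rewrite ltr0n.
apply: covered_le (dP _ _ ln) _.
have : covered (fun g => (L g <= r)%N) (fun g => act g^-1%g (c g (g * h)%g)) n.
  have [F FP] := covered_of_card x0 cn; exists F => g /L0_le Lg.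
  exact: FP g Lg.
move=> cov; apply: (covered_pair (E := fun w j => (s w * stab (o w) j)%g) cov).
move=> g _; set y := c g _; set w := act g^-1%g y.
have [|j ltj stE] := stabP (o w) ((s w)^-1 * (g^-1 * s y))%g.
  have ow : o w = o y by rewrite /w oP.
  by rewrite !actM ow sP -/w sV.
by exists j; [exact: ltnW | rewrite stE mulVKg].
Qed.

End FromMetric.

Section LengthMetric.
Variables (R : realType) (H : groupType) (L : H -> nat) (L_len : is_length L).

(** The proof that [L] is a length is part of the type so that the instances below
can find it. *)
Definition length_metric of is_length L : Type := H.
Local Notation X := (length_metric L_len).

HB.instance Definition _ := Choice.on X.

Definition length_dist (x y : X) : R := (L ((x : H)^-1 * (y : H)))%:R%R.

Lemma length_distxx x : length_dist x x = 0%R.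
Proof. by rewrite /length_dist mulVg; have [-> _ _ _] := L_len. Qed.

Lemma length_dist_eq0 x y : length_dist x y = 0%R -> x = y.
Proof.
move=> /eqP; rewrite pnatr_eq0 => /eqP; have [_ L0 _ _] := L_len.
by move=> /L0 /(congr1 (fun t : H => (x : H) * t)); rewrite /= mulVKg mulg1.
Qed.

Lemma length_distC x y : length_dist x y = length_dist y x.
Proof.
by rewrite /length_dist; have [_ _ <- _] := L_len; rewrite invgM invgK.
Qed.

Lemma length_dist_triangle y x z :
  (length_dist x z <= length_dist x y + length_dist y z)%R.
Proof.
rewrite /length_dist -natrD ler_nat; have [_ _ _ LM] := L_len.
by apply: leq_trans (LM _ _); rewrite mulgA mulgK.
Qed.

HB.instance Definition _ := isMetric.Build R X
  length_distxx length_dist_eq0 length_distC length_dist_triangle.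

Definition length_space : metricType R := X.

End LengthMetric.

Section ToMetric.
Variable R : realType.
Local Open Scope ring_scope.

Lemma property_of_centroid (H : groupType) (L : H -> nat) c d :
  countable [set: H]%classic -> is_length L -> is_centroid L c d ->
  centroid_property R H.
Proof.
move=> cH L_len [c1 c2 c3]; split=> //.
pose X := length_space R L_len.
pose act (g : H) (x : X) : X := (g * (x : H))%g.
have LE g : mdist (1%g : X) (act g (1%g : X)) = (L g)%:R.
  by rewrite /mdist /= /length_dist /act invg1 mul1g mulg1.
(* The value of this polynomial at n is rate d n. *)
exists X, act, (1%g : X), c, (('X + 2%:P) ^+ d).
have rate_poly (n : nat) (r : R) : n%:R <= r ->
    (rate d n)%:R <= (('X + 2%:P) ^+ d).[r].
  move=> le_n; rewrite horner_exp hornerD hornerX hornerC /rate natrX.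
  have le_n2 : n.+2%:R <= r + 2 by rewrite -addn2 natrD lerD2r.
  by apply: lerXn2r; rewrite ?nnegrE // (le_trans _ le_n2).
have le_trunc (r : R) g : 0 < r -> (L g)%:R <= r -> (L g <= Num.truncn r)%N.
  by move=> r0; rewrite truncn_ge_nat // ltW.
split; [|split; [|split]].
- split=> [x|g h x|g x y].
  + exact: mul1g.
  + by rewrite /act mulgA.
  + by rewrite /mdist /= /length_dist /act invgM -mulgA mulKg.
- exists 1%N => x; rewrite -[stabilizer act x]image_id; apply: card_of_covered.
  exists (fun=> 1%g) => g gx; exists 0%N => //.
  by apply: (@mulIg _ (x : H)); rewrite mul1g.
- apply/polyOverP => i; rewrite nnegrE; elim: (d) i => [|n IH] i.
    by rewrite expr0 coef1.
  rewrite exprS mulrDl coefD coefXM coefCM addr_ge0 ?mulr_ge0 //.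
  by case: eqP.
split=> [k r r0|g|h r r0].
- exists (rate d (Num.truncn r)); last by apply: rate_poly; rewrite truncn_le ltW.
  apply: card_of_covered; have [F FP] := c1 k (Num.truncn r).
  by exists F => g; rewrite /= LE => /(le_trunc _ _ r0); apply: FP.
- exists (rate d (L g)); last by apply: rate_poly; rewrite LE.
  by apply: card_of_covered; have [F FP] := c2 g; exists F => k _; apply: FP.
- exists (rate d (Num.truncn r)); last by apply: rate_poly; rewrite truncn_le ltW.
  apply: card_of_covered; have [F FP] := c3 h (Num.truncn r).
  by exists F => g; rewrite /= LE => /(le_trunc _ _ r0); apply: FP.
Qed.

End ToMetric.

(** * Normal forms in a graph product *)

Section Pilings.
Variables (V : finType) (e : rel V) (G : V -> groupType).
Hypotheses (e_sym : symmetric e) (e_irrefl : irreflexive e).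

Local Notation GP := (graph_product e G).
Local Notation EC := (@edge_commutators V e G).

Definition gp_inj v (s : G v) : GP :=
  quot_pi EC (fp_inj s).

Lemma gp_injM v : {morph @gp_inj v : s t / s * t}.
Proof. by move=> s t; rewrite /gp_inj fp_injM quot_piM. Qed.

Lemma gp_inj1 v : gp_inj (1 : G v) = 1.
Proof. by apply: (@mulgI GP (gp_inj (1 : G v))); rewrite -gp_injM !mulg1. Qed.

Lemma gp_injV v (s : G v) : gp_inj s^-1 = (gp_inj s)^-1.
Proof. by apply: (@mulgI GP (gp_inj s)); rewrite -gp_injM !mulgV gp_inj1. Qed.

Lemma gp_injC u v (s : G u) (t : G v) :
  e u v -> gp_inj s * gp_inj t = gp_inj t * gp_inj s.
Proof.
move=> uv; apply/commgP/eqP.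
have -> : [~ gp_inj s, gp_inj t] =
    quot_pi EC [~ fp_inj s, fp_inj t].
  by rewrite /commg /conjg !quot_piM -!quot_invE.
apply/quot_piP; have [_ _ NV _] := normal_closureP EC.
rewrite mulg1; apply: NV; apply: sub_normal_closure.
by rewrite /edge_commutators /=; exists u, v, s, t.
Qed.

(** The graph product is generated by the vertex groups. *)
Lemma gp_gen_ind (P : GP -> Prop) :
    P 1 -> (forall v (s : G v) g, P g -> P (gp_inj s * g)) ->
  forall g, P g.
Proof.
move=> P1 PM; elim/quot_ind; elim/fp_ind => w.
elim: w => [|[v s] w Pw]; first exact: P1.
have -> : fp_of_word ((existT _ v s) :: w) = fp_inj s * fp_of_word w.
  by rewrite -[RHS]/(fp_mul _ _) fp_mulE.
by rewrite quot_piM; apply: PM.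
Qed.

(** A piling is a stack of letters over each vertex, where the trivial letter 1
serves as a marker. Placing a letter [s] at [v] puts a marker on every other
stack that does not belong to a neighbour of [v]; the marker records that the
letters below it cannot be moved in front of [s]. Two reduced words that
differ by exchanging letters of adjacent vertices thus yield the same piling. *)
Definition piling := forall v, seq (G v).
Implicit Types (sigma tau : piling).

Definition empty_piling : piling := fun=> [::].

(** The contribution of [s] to the stack over [u] when [u] is not a neighbour of
[v]: the letter itself if [u = v], a marker otherwise. *)
Definition at_vertex v (s : G v) u : G u :=
  if v =P u is ReflectT vu then ecast w (G w) vu s else 1.

Lemma at_vertexE v (s : G v) : at_vertex s v = s.
Proof. by rewrite /at_vertex; case: eqP => // vv; rewrite eq_axiomK. Qed.

Lemma at_vertex_neq v (s : G v) u : v != u -> at_vertex s u = 1.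
Proof. by rewrite /at_vertex; case: eqP. Qed.

Definition push v (s : G v) sigma : piling :=
  fun u => if e v u then sigma u else at_vertex s u :: sigma u.

Definition pop v sigma : piling :=
  fun u => if e v u then sigma u else behead (sigma u).

Definition top sigma v : G v := head 1 (sigma v).

Lemma piling_eq sigma tau : (forall v, sigma v = tau v) -> sigma = tau.
Proof. by move=> eq_st; apply: functional_extensionality_dep. Qed.

Lemma pushK v (s : G v) : cancel (push s) (pop v).
Proof. by move=> sigma; apply: piling_eq => u; rewrite /pop /push; case: (e v u). Qed.

Lemma top_push v (s : G v) sigma : top (push s sigma) v = s.
Proof. by rewrite /top /push e_irrefl /= at_vertexE. Qed.

Lemma top_push_adj u v (s : G v) sigma :
  e v u -> top (push s sigma) u = top sigma u.
Proof. by rewrite /top /push => ->. Qed.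

Lemma top_push_nadj u v (s : G v) sigma :
  ~~ e v u -> v != u -> top (push s sigma) u = 1.
Proof. by rewrite /top /push => /negPf-> /at_vertex_neq->. Qed.

Lemma pushC u v (s : G u) (t : G v) sigma :
  e u v -> push s (push t sigma) = push t (push s sigma).
Proof.
move=> uv; apply: piling_eq => w; rewrite /push.
case: ifPn => // nuw; case: ifPn => // nvw.
rewrite !at_vertex_neq //; first by apply: contraNneq nuw => <-.
by apply: contraNneq nvw => <-; rewrite e_sym.
Qed.

Definition strip v sigma : piling :=
  if top sigma v == 1 then sigma else pop v sigma.

Definition join v (t : G v) sigma : piling :=
  if t == 1 then sigma else push t sigma.

Lemma top_join v (t : G v) sigma : top sigma v = 1 -> top (join t sigma) v = t.
Proof. by rewrite /join; case: eqP => [->//|_] _; rewrite top_push. Qed.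

Lemma top_join_adj u v (t : G v) sigma :
  e v u -> top (join t sigma) u = top sigma u.
Proof. by rewrite /join; case: eqP => // _ /top_push_adj->. Qed.

Lemma joinK v (t : G v) sigma : top sigma v = 1 -> strip v (join t sigma) = sigma.
Proof.
move=> top1; rewrite /strip top_join // /join.
by case: eqP => // _; rewrite pushK.
Qed.

Lemma joinC u v (s : G u) (t : G v) sigma :
  e u v -> join s (join t sigma) = join t (join s sigma).
Proof. by rewrite /join => uv; do 2!case: eqP => // _; apply: pushC. Qed.

(** The pilings of reduced words, with the elements that these words represent.
The condition [top sigma v = 1] forbids that [s] meets another letter of its
own vertex group. *)
Inductive piling_of : piling -> GP -> Prop :=
| PilingEmpty : piling_of empty_piling 1
| PilingPush v (s : G v) sigma g of s != 1 & top sigma v = 1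
    & piling_of sigma g : piling_of (push s sigma) (gp_inj s * g).

(** A letter on top of the stack over [v] can be moved to the front of the reduced
word: a letter [s] placed later at another vertex [u] must be a neighbour of
[v], since otherwise it would have left a marker over [v]. *)
Lemma piling_of_strip v sigma g : piling_of sigma g ->
  [/\ piling_of (strip v sigma) (gp_inj (top sigma v)^-1 * g),
      top (strip v sigma) v = 1 &
      join (top sigma v) (strip v sigma) = sigma].
Proof.
have triv sigma' g' : top sigma' v = 1 -> piling_of sigma' g' ->
  [/\ piling_of (strip v sigma') (gp_inj (top sigma' v)^-1 * g'),
      top (strip v sigma') v = 1 &
      join (top sigma' v) (strip v sigma') = sigma'].
  by move=> top1 sg; rewrite /join /strip top1 eqxx invg1 gp_inj1 mul1g.
elim=> [|u s tau h s1 tau1 th IH]; first by apply: triv => //; constructor.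
have [top1|top_n1] := eqVneq (top (push s tau) v) 1.
  by apply: triv => //; constructor.
have [eq_uv|neq_uv] := eqVneq u v.
  case: v / eq_uv triv top_n1 IH => triv top_n1 IH.
  rewrite /strip /join (negPf top_n1) top_push pushK.
  by rewrite gp_injV mulKg.
have [uv|nuv] := boolP (e u v); last by rewrite top_push_nadj ?eqxx in top_n1.
rewrite /strip (negPf top_n1); move: top_n1; rewrite top_push_adj // => top_n1.
have [] := IH; rewrite /strip /join (negPf top_n1) => th' top1 tauE.
have -> : pop v (push s tau) = push s (pop v tau).
  by rewrite -{1}tauE pushC // pushK.
split; last by rewrite -pushC // tauE.
- rewrite mulgA -(gp_injC _ _ uv) -mulgA.
  constructor=> //.
  by rewrite -tau1 -[in RHS]tauE top_push_adj // e_sym.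
by rewrite top_push_adj.
Qed.

(** Left multiplication by [s]: the top letter over [v] is removed, multiplied by
[s] and put back if nontrivial. *)
Definition act_letter v (s : G v) sigma : piling :=
  join (s * top sigma v) (strip v sigma).

Lemma act_join v (s t : G v) sigma :
  top sigma v = 1 -> act_letter s (join t sigma) = join (s * t) sigma.
Proof. by move=> top1; rewrite /act_letter top_join // joinK. Qed.

Lemma piling_of_join v (t : G v) sigma g : top sigma v = 1 ->
  piling_of sigma g -> piling_of (join t sigma) (gp_inj t * g).
Proof.
rewrite /join; case: eqP => [->|/eqP t1] top1 sg.
  by rewrite gp_inj1 mul1g.
by constructor.
Qed.

Lemma piling_of_act v (s : G v) sigma g :
  piling_of sigma g -> piling_of (act_letter s sigma) (gp_inj s * g).
Proof.
move=> /(piling_of_strip v)[sg top1 _].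
have -> : gp_inj s * g =
    gp_inj (s * top sigma v) * (gp_inj (top sigma v)^-1 * g).
  by rewrite gp_injM mulgA gp_injV mulgK.
exact: piling_of_join.
Qed.

Definition valid sigma := exists g, piling_of sigma g.

Lemma valid_act v (s : G v) sigma : valid sigma -> valid (act_letter s sigma).
Proof. by case=> g sg; exists (gp_inj s * g); apply: piling_of_act. Qed.

(** Valid pilings are thus pairs of an element of the group at [v] and a valid piling
with no letter on top of [v], on which [act_letter] is multiplication in the
first component; the axioms of an action follow. *)
Lemma valid_join v sigma : valid sigma ->
  exists (a : G v) tau, [/\ valid tau, top tau v = 1 & sigma = join a tau].
Proof.
move=> [g /(piling_of_strip v)[sg top1 sigmaE]].
by exists (top sigma v), (strip v sigma); split=> //; eexists; exact: sg.
Qed.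

Lemma act1 v sigma : valid sigma -> act_letter (1 : G v) sigma = sigma.
Proof.
by move=> /(valid_join v)[a [tau [_ top1 ->]]]; rewrite act_join // mul1g.
Qed.

Lemma actM v (s t : G v) sigma : valid sigma ->
  act_letter (s * t) sigma = act_letter s (act_letter t sigma).
Proof.
by move=> /(valid_join v)[a [tau [_ top1 ->]]]; rewrite !act_join // mulgA.
Qed.

Lemma actC u v (s : G u) (t : G v) sigma : e u v -> valid sigma ->
  act_letter s (act_letter t sigma) = act_letter t (act_letter s sigma).
Proof.
move=> uv /(valid_join v)[b [tau [vtau top_v ->]]].
have vu : e v u by rewrite e_sym.
have [a [rho [_ top_u tauE]]] := valid_join u vtau.
have rho_v : top rho v = 1 by rewrite -top_v tauE top_join_adj.
have join_u c : top (join (c : G v) rho) u = 1 by rewrite top_join_adj.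
have join_v c : top (join (c : G u) rho) v = 1 by rewrite top_join_adj.
rewrite tauE act_join // (joinC _ _ _ vu) act_join //.
rewrite (joinC b a _ vu) act_join //.
by rewrite !(joinC _ _ _ uv) act_join.
Qed.

Definition act_word (w : seq {v : V & G v}) sigma : piling :=
  foldr (fun l => act_letter (tagged l)) sigma w.

Lemma act_word_cat w1 w2 sigma :
  act_word (w1 ++ w2) sigma = act_word w1 (act_word w2 sigma).
Proof. exact: foldr_cat. Qed.

Lemma valid_act_word w sigma : valid sigma -> valid (act_word w sigma).
Proof. by move=> vs; elim: w => //= l w; apply: valid_act. Qed.

(** This is where normal forms become unique: the action of a word only depends on
the element of the free product, and then on that of the graph product by
[act_fp_closure]. *)
Lemma act_word_eq w1 w2 sigma :
  word_eq w1 w2 -> valid sigma -> act_word w1 sigma = act_word w2 sigma.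
Proof.
move=> eq_w; elim: eq_w sigma => {w1 w2} [//|w1 w2 _ IH|w1 w2 w3 _ IH1 _ IH2
  |w1 w2 w3 w4 _ IH1 _ IH2|v|v s t] sigma vs.
- by rewrite IH.
- by rewrite IH1 // IH2.
- by rewrite !act_word_cat IH2 // IH1 //; apply: valid_act_word.
- exact: act1.
- by rewrite /= -actM.
Qed.

Definition act_fp (x : free_product G) sigma : piling := act_word (repr x) sigma.

Lemma act_fpE w sigma :
  valid sigma -> act_fp (fp_of_word w) sigma = act_word w sigma.
Proof. by apply: act_word_eq; apply: repr_fp. Qed.

Lemma valid_act_fp x sigma : valid sigma -> valid (act_fp x sigma).
Proof. exact: valid_act_word. Qed.

Lemma act_fpM x y sigma : valid sigma ->
  act_fp (x * y) sigma = act_fp x (act_fp y sigma).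
Proof.
move=> vs; rewrite -[x * y]/(fp_mul x y) act_fpE //.
exact: act_word_cat.
Qed.

Lemma act_fp1 sigma : valid sigma -> act_fp 1 sigma = sigma.
Proof. by move=> vs; rewrite -[1]/(fp_of_word [::]) act_fpE. Qed.

Lemma act_fp_inj v (s : G v) sigma : valid sigma ->
  act_fp (fp_inj s) sigma = act_letter s sigma.
Proof. exact: act_fpE. Qed.

(** The elements acting trivially on valid pilings form a normal subgroup containing
the defining commutators. *)
Lemma act_fp_closure x sigma : normal_closure EC x ->
  valid sigma -> act_fp x sigma = sigma.
Proof.
move=> Nx; move: sigma; pose N x := forall sigma, valid sigma -> act_fp x sigma = sigma.
apply: (Nx N); split; last first.
  move=> _ [u [v [s [t [uv ->]]]]] sigma vs.
  have -> : [~ fp_inj s, fp_inj t] =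
      (fp_inj t * fp_inj s)^-1 * (fp_inj s * fp_inj t).
    by rewrite invgM -!mulgA.
  have act_st : act_fp (fp_inj s * fp_inj t) sigma =
      act_fp (fp_inj t * fp_inj s) sigma.
    rewrite !act_fpM // (act_fp_inj s vs) (act_fp_inj t vs).
    rewrite (act_fp_inj s (valid_act t vs)) (act_fp_inj t (valid_act s vs)).
    exact: actC.
  by rewrite act_fpM // act_st -act_fpM // mulVg act_fp1.
split=> [sigma /act_fp1//|y z Ny Nz sigma vs|y Ny sigma vs|y z Ny sigma vs].
- by rewrite act_fpM // Nz // Ny.
- by rewrite -{1}(Ny _ vs) -act_fpM // mulVg act_fp1.
- rewrite /conjg !(act_fpM _ _ vs) Ny; last exact: valid_act_fp.
  by rewrite -act_fpM // mulVg act_fp1.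
Qed.

Definition pil (g : GP) : piling := act_fp (repr g) empty_piling.

Lemma valid_empty : valid empty_piling.
Proof. by exists 1; constructor. Qed.

Lemma pil_pi x : pil (quot_pi EC x) = act_fp x empty_piling.
Proof.
have := @repr_quot _ EC x.
rewrite /pil; set y := repr _ => Nyx.
rewrite -{1}(act_fp_closure Nyx valid_empty) -act_fpM; last exact: valid_empty.
by rewrite mulVKg.
Qed.

Lemma pil1 : pil 1 = empty_piling.
Proof. by rewrite pil_pi act_fp1 //; apply: valid_empty. Qed.

Lemma pil_cons v (s : G v) g : pil (gp_inj s * g) = act_letter s (pil g).
Proof.
elim/quot_ind: g => x; rewrite /gp_inj -quot_piM !pil_pi act_fpM.
  by rewrite act_fp_inj //; apply/valid_act_fp/valid_empty.
exact: valid_empty.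
Qed.

Lemma pilP g : piling_of (pil g) g.
Proof.
elim/gp_gen_ind: g => [|v s g IH]; first by rewrite pil1; constructor.
by rewrite pil_cons; apply: piling_of_act.
Qed.

Lemma pilE sigma g : piling_of sigma g -> pil g = sigma.
Proof.
elim=> [|v s tau h s1 tau1 _ IH]; first exact: pil1.
rewrite pil_cons IH /act_letter /strip tau1 eqxx mulg1 /join.
by rewrite (negPf s1).
Qed.

Definition hd v (g : GP) : G v := top (pil g) v.

Lemma hd1 v : hd v 1 = 1.
Proof. by rewrite /hd pil1. Qed.

Lemma hd_cons v (s : G v) g : hd v (gp_inj s * g) = s * hd v g.
Proof.
by rewrite /hd pil_cons; have [_ top1 _] := piling_of_strip v (pilP g); rewrite top_join.
Qed.

Lemma hd_cons_adj u v (s : G u) g : e u v -> hd v (gp_inj s * g) = hd v g.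
Proof.
move=> uv; rewrite /hd pil_cons; have [_ _ sE] := piling_of_strip u (pilP g).
by rewrite top_join_adj // -[in RHS]sE top_join_adj.
Qed.

(** The head at [u] can be taken as the letter placed last, and then leaves a marker
over every other vertex that is not a neighbour of [u]. *)
Lemma hd_clique u v g : hd u g != 1 -> hd v g != 1 -> u != v -> e u v.
Proof.
rewrite /hd => hu hv neq_uv; have [_ _ sE] := piling_of_strip u (pilP g).
apply: contraNT hv => nuv; rewrite -sE /join (negPf hu).
by rewrite top_push_nadj.
Qed.

(** Induction on a reduced word. *)
Lemma gp_ind (P : GP -> Prop) :
    P 1 ->
    (forall v (s : G v) g, s != 1 -> hd v g = 1 -> P g -> P (gp_inj s * g)) ->
  forall g, P g.
Proof.
move=> P1 PM g; elim: (pilP g) => // v s sigma h s1 top1 sh Ph.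
by apply: PM => //; rewrite /hd (pilE sh).
Qed.

(** The additive extension of a weight of letters to reduced words. Three weights are
used: the length functions of the vertex groups, the number of letters, and the
number of letters at a given vertex. *)
Definition len (w : forall v, G v -> nat) (g : GP) : nat :=
  \sum_v sumn [seq w v s | s <- pil g v].

Lemma len1 w : len w 1 = 0.
Proof. by rewrite /len big1 // => v _; rewrite pil1. Qed.

Lemma len_cons w v (s : G v) g : (forall u, w u 1 = 0) -> hd v g = 1 ->
  len w (gp_inj s * g) = w v s + len w g.
Proof.
move=> w1 hv; rewrite /len pil_cons /act_letter /strip -/(hd v g) hv eqxx mulg1.
rewrite /join; case: eqP => [->|_]; first by rewrite w1.
rewrite (bigD1 v) //= [in RHS](bigD1 v) //= addnA; congr (_ + _).
  by rewrite /push e_irrefl /= at_vertexE.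
apply: eq_bigr => u neq_uv; rewrite /push; case: ifP => // _ /=.
by rewrite at_vertex_neq ?w1 // eq_sym.
Qed.

(** * Lengths and reduced products *)

Definition tail v (g : GP) : GP := (gp_inj (hd v g))^-1 * g.

Lemma tailK v g : gp_inj (hd v g) * tail v g = g.
Proof. by rewrite /tail mulVKg. Qed.

Lemma hd_tail v g : hd v (tail v g) = 1.
Proof. by rewrite /tail -gp_injV hd_cons mulVg. Qed.

Lemma len_tail w v g : (forall u, w u 1 = 0) ->
  len w g = w v (hd v g) + len w (tail v g).
Proof. by move=> w1; rewrite -{1}(tailK v g) len_cons // hd_tail. Qed.

Section Weight.
Variables (w : forall v, G v -> nat) (w_len : forall v, is_length (@w v)).

Let w1 v : @w v 1 = 0. Proof. by have [] := w_len v. Qed.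

(** A prepended letter is either a new letter of the reduced word or multiplied with
a head. *)
Lemma len_cons_le v (s : G v) g : len w (gp_inj s * g) <= w s + len w g.
Proof.
rewrite -{1}(tailK v g) mulgA -gp_injM len_cons ?hd_tail // (len_tail v g w1).
by rewrite addnA leq_add2r; have [_ _ _] := w_len v.
Qed.

Lemma lenM_le g h : len w (g * h) <= len w g + len w h.
Proof.
elim/gp_ind: g h => [|v s g s1 hg IH] h; first by rewrite mul1g len1.
rewrite len_cons // -mulgA; apply: leq_trans (len_cons_le _ _) _.
by rewrite -addnA leq_add2l.
Qed.

Lemma len_gp_inj v (s : G v) : len w (gp_inj s) = w s.
Proof. by rewrite -[gp_inj s]mulg1 len_cons ?hd1 // len1 addn0. Qed.

Lemma lenV g : len w g^-1 = len w g.
Proof.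
have leV h : len w h^-1 <= len w h.
  elim/gp_ind: h => [|v s h s1 hh IH]; first by rewrite invg1.
  rewrite invgM len_cons // -gp_injV addnC; apply: leq_trans (lenM_le _ _) _.
  by rewrite len_gp_inj; have [_ _ -> _] := w_len v; rewrite leq_add2r.
by apply/eqP; rewrite eqn_leq leV -{1}[g]invgK leV.
Qed.

Lemma len_is_length : is_length (len w).
Proof.
split; [exact: len1| |exact: lenV|exact: lenM_le].
elim/gp_ind=> // v s g s1 hg _ /eqP; rewrite len_cons // addn_eq0 => /andP[/eqP ws _].
by have [_ w0 _ _] := w_len v; rewrite (w0 _ ws) eqxx in s1.
Qed.

Lemma weight_hd_le v g : w (hd v g) <= len w g.
Proof. by rewrite (len_tail v g w1) leq_addr. Qed.

End Weight.

Definition syl_weight v (s : G v) : nat := s != 1.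
Definition vertex_weight u v (s : G v) : nat := (v == u) && (s != 1).

Local Notation N := (len syl_weight).

Lemma syl_weight1 v : syl_weight (1 : G v) = 0.
Proof. by rewrite /syl_weight eqxx. Qed.

Lemma vertex_weight1 u v : vertex_weight u (1 : G v) = 0.
Proof. by rewrite /vertex_weight eqxx andbF. Qed.

Lemma syl_weight_length v : is_length (@syl_weight v).
Proof.
split=> [|x|x|x y]; rewrite /syl_weight ?eqxx ?invg_eq1 //; first by case: eqP.
have [->|x1] := eqVneq x 1; first by rewrite mul1g leq_addl.
by case: (x * y != 1).
Qed.

Lemma len_le (w w' : forall v, G v -> nat) g :
  (forall v s, w v s <= w' v s) -> len w g <= len w' g.
Proof.
move=> le_w; apply: leq_sum => v _.
by elim: (pil g v) => //= s l IH; apply: leq_add.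
Qed.

(** A product is reduced if no letters merge or cancel. Counting letters makes this
symmetric in the two factors, and compatible with associativity. *)
Definition red (x y : GP) := N (x * y) == N x + N y.

Lemma red1 x : red 1 x.
Proof. by rewrite /red mul1g len1. Qed.

(** Both sides say that the number of letters of [x * y * z] is the sum of those of
the factors. *)
Lemma red_assoc x y z : red x y && red (x * y) z = red y z && red x (y * z).
Proof.
have := lenM_le syl_weight_length x y; have := lenM_le syl_weight_length (x * y) z.
have := lenM_le syl_weight_length y z; have := lenM_le syl_weight_length x (y * z).
rewrite /red mulgA; set a := N (x * y); set b := N (y * z).
set c := N (x * y * z); lia.
Qed.

Lemma red_letter v (s : G v) g : s != 1 -> red (gp_inj s) g = (hd v g == 1).
Proof.
move=> s1; rewrite /red (len_gp_inj syl_weight_length).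
rewrite -{1}(tailK v g) mulgA -gp_injM len_cons ?hd_tail //; last exact: syl_weight1.
rewrite (len_tail v g syl_weight1) addnA eqn_add2r /syl_weight s1.
by have [->|h1] := eqVneq (hd v g) 1; rewrite ?mulg1 ?s1 //; case: (_ != 1).
Qed.

(** Peels the first letter off a reduced product; most facts below are proved by
induction along it. *)
Lemma red_cons v (s : G v) x y : s != 1 -> hd v x = 1 ->
  red (gp_inj s * x) y = red x y && (hd v (x * y) == 1).
Proof.
move=> s1 hx; rewrite -(red_letter _ s1) -red_assoc.
by rewrite red_letter // hx eqxx.
Qed.

(** A head of a prefix is never modified by what follows it. *)
Lemma red_hd v x y : red x y -> hd v x != 1 -> hd v (x * y) = hd v x.
Proof.
move=> rxy hx; move: rxy; rewrite -{1}(tailK v x) red_cons ?hd_tail //.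
move=> /andP[_ /eqP h1].
by rewrite -{1}(tailK v x) -mulgA hd_cons h1 mulg1.
Qed.

Lemma len_red w x y : (forall v, w v 1 = 0) -> red x y ->
  len w (x * y) = len w x + len w y.
Proof.
move=> w1; elim/gp_ind: x => [|v s x s1 hx IH]; first by rewrite mul1g len1.
rewrite red_cons // => /andP[/IH{}IH /eqP hxy].
by rewrite -mulgA !len_cons // IH addnA.
Qed.

(** In [x^-1 * y] only letters that can be moved to the end of [x^-1] and to the front
of [y] can interact. Moving the first letter [s] of [x] over to [y] preserves the
hypothesis: after it, a common vertex of heads of the new elements must be
adjacent to [v], hence is a common vertex of heads of the original ones. *)
Lemma red_invl x y : (forall v, hd v x != 1 -> hd v y = 1) -> red x^-1 y.
Proof.
elim/gp_ind: x y => [|v s x s1 hx IH] y hxy; first by rewrite invg1 red1.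
have hy : hd v y = 1 by apply: hxy; rewrite hd_cons hx mulg1.
have sV1 : s^-1 != 1 by rewrite invg_eq1.
rewrite invgM; have : red x^-1 ((gp_inj s)^-1 * y).
  apply: IH => u hu; have neq_vu : v != u.
    by apply: contraNneq hu => <-; apply/eqP.
  have hv : hd v (gp_inj s^-1 * y) != 1 by rewrite hd_cons hy mulg1.
  have [vu|nvu] := boolP (e v u).
    by rewrite -gp_injV hd_cons_adj //; apply: hxy; rewrite hd_cons_adj.
  apply/eqP; rewrite -gp_injV; apply: contraNT nvu => hu'.
  exact: hd_clique hv hu' neq_vu.
have rs : red (gp_inj s)^-1 y by rewrite -gp_injV red_letter // hy.
by move=> rx; have := red_assoc x^-1 (gp_inj s)^-1 y; rewrite rs rx => /andP[].
Qed.

Definition ncount u := len (@vertex_weight u).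

Lemma ncount_cons u v (s : G v) g : s != 1 -> hd v g = 1 ->
  ncount u (gp_inj s * g) = (v == u) + ncount u g.
Proof.
move=> s1 hg; rewrite /ncount len_cons //; first by rewrite /vertex_weight s1 andbT.
exact: vertex_weight1.
Qed.

Lemma ncount0 g : (forall u, ncount u g = 0) -> g = 1.
Proof.
elim/gp_ind: g => // v s g s1 hg _ /(_ v).
by rewrite ncount_cons // eqxx.
Qed.

(** The letters of [x * z] at [v] are linearly ordered, so that a prefix containing
one of them contains the first one. *)
Lemma prefix_hd v x z : red x z -> hd v (x * z) != 1 -> 0 < ncount v x ->
  hd v x = hd v (x * z).
Proof.
elim/gp_ind: x => [|u t x t1 hx IH]; first by rewrite /ncount len1.
move=> rtx; have hu : hd u (gp_inj t * x) = t by rewrite hd_cons hx mulg1.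
have hu' : hd u (gp_inj t * x * z) = t by rewrite red_hd ?hu.
have [eq_uv|neq_uv] := eqVneq u v; first by rewrite -eq_uv hu hu'.
move=> hv; have uv : e u v by apply: hd_clique hv neq_uv; rewrite hu'.
rewrite ncount_cons // (negPf neq_uv) -mulgA !hd_cons_adj // => n0.
move: rtx hv; rewrite red_cons // -mulgA hd_cons_adj // => /andP[rxz _] hv.
exact: IH.
Qed.

(** Prefixes of an element are the lower ideals of the poset of its letters. Since
letters at the same vertex form a chain, an ideal is determined by the number
of letters at each vertex. *)
Lemma prefix_uniq x z x' z' : red x z -> red x' z' -> x * z = x' * z' ->
  (forall u, ncount u x = ncount u x') -> x = x'.
Proof.
elim/gp_ind: x x' => [|v s x s1 hx IH] x' rxz rxz' eq_k eq_n.
  by apply/esym/ncount0 => u; rewrite -eq_n /ncount len1.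
have hk : hd v (x' * z') = s.
  by rewrite -eq_k red_hd // hd_cons hx mulg1.
have hx' : hd v x' = s.
  rewrite -hk; apply: prefix_hd => //; first by rewrite hk.
  by rewrite -eq_n ncount_cons // eqxx.
have x'E : x' = gp_inj s * tail v x' by rewrite -hx' tailK.
move: (tail v x') (hd_tail v x') x'E {hk hx'} => t ht x'E.
rewrite {}x'E in rxz' eq_k eq_n *; congr (_ * _); apply: IH.
- by move: rxz; rewrite red_cons // => /andP[].
- by move: rxz'; rewrite red_cons // => /andP[].
- by apply: (@mulgI GP (gp_inj s)); rewrite !mulgA.
- by move=> u; have := eq_n u; rewrite !ncount_cons //; apply: addnI.
Qed.

(** Common heads are moved to the prefix as long as there are any. *)
Lemma common_prefix g k : exists x g' k', [/\ red x g', red x k', g = x * g',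
  k = x * k' & forall v, hd v g' != 1 -> hd v g' != hd v k'].
Proof.
have [n] := ubnP (N g); elim: n g k => // n IH g k lt_g.
have [/existsP[v /andP[hg /eqP hgk]]|/existsPn no_v] :=
    boolP [exists v, (hd v g != 1) && (hd v g == hd v k)]; last first.
  exists 1, g, k; rewrite !red1 !mul1g; split=> // v hg.
  by have := no_v v; rewrite hg.
have [|x [g' [k' [rg rk gE kE sep]]]] := IH (tail v g) (tail v k).
  by move: lt_g; rewrite (len_tail v g syl_weight1) /syl_weight hg; lia.
have hx : hd v x = 1.
  apply/eqP; apply: contraT => hx; have := hx.
  by rewrite -(red_hd rg hx) -gE hd_tail eqxx.
exists (gp_inj (hd v g) * x), g', k'; split=> //.
- by rewrite red_cons // rg -gE hd_tail eqxx.
- by rewrite red_cons // rk -kE hd_tail eqxx.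
- by rewrite -mulgA -gE tailK.
- by rewrite -mulgA -kE hgk tailK.
Qed.

(** * Products over cliques *)

Definition clique (C : seq V) :=
  uniq C /\ {in C &, forall u v, u != v -> e u v}.

Definition cprod (C : seq V) (f : forall v, G v) : GP :=
  \prod_(v <- C) gp_inj (f v).

Lemma cprod_nil f : cprod [::] f = 1.
Proof. by rewrite /cprod big_nil. Qed.

Lemma cprod_cons v C f : cprod (v :: C) f = gp_inj (f v) * cprod C f.
Proof. by rewrite /cprod big_cons. Qed.

Lemma clique_cons v C : clique (v :: C) ->
  clique C /\ {in C, forall u, e v u}.
Proof.
move=> [/= /andP[vC uC] adj]; split.
  by split=> // a b aC bC; apply: adj; rewrite inE ?aC ?bC orbT.
move=> u Cu; apply: adj; rewrite ?inE ?eqxx ?Cu ?orbT //.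
by apply: contraNneq vC => ->.
Qed.

Lemma eq_cprod C f f' : {in C, forall v, f v = f' v} -> cprod C f = cprod C f'.
Proof. by move=> eq_f; apply: eq_big_seq => v /eq_f->. Qed.

Lemma cprod1 C : cprod C (fun=> 1) = 1.
Proof. by rewrite /cprod big1 // => v _; rewrite gp_inj1. Qed.

Lemma cprod_comm v (s : G v) C f : {in C, forall u, e v u} ->
  gp_inj s * cprod C f = cprod C f * gp_inj s.
Proof.
elim: C => [|u C IH] adj; first by rewrite cprod_nil mulg1 mul1g.
rewrite cprod_cons -mulgA -IH => [|a Ca]; last by rewrite adj // inE Ca orbT.
by rewrite !mulgA (gp_injC _ _ (adj u _)) ?mem_head.
Qed.

Lemma cprodM C f f' : clique C ->
  cprod C f * cprod C f' = cprod C (fun v => f v * f' v).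
Proof.
elim: C => [|v C IH]; first by rewrite !cprod_nil mulg1.
move=> /clique_cons[cC adj]; rewrite !cprod_cons gp_injM -IH //.
by rewrite !mulgA -(mulgA (gp_inj (f v))) -(cprod_comm _ _ adj) !mulgA.
Qed.

Lemma cprodV C f : clique C -> (cprod C f)^-1 = cprod C (fun v => (f v)^-1).
Proof.
move=> cC; apply: (@mulgI GP (cprod C f)); rewrite mulgV cprodM // -(cprod1 C).
by apply: eq_cprod => v _; rewrite mulgV.
Qed.

Lemma hd_cprod_adj u C f z : {in C, forall v, e v u} ->
  hd u (cprod C f * z) = hd u z.
Proof.
elim: C => [|v C IH] adj; first by rewrite cprod_nil mul1g.
rewrite cprod_cons -mulgA hd_cons_adj ?adj ?mem_head // IH // => a Ca.
by rewrite adj // inE Ca orbT.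
Qed.

Lemma hd_cprod u C f z : clique C -> u \in C ->
  hd u (cprod C f * z) = f u * hd u z.
Proof.
elim: C => // v C IH cvC; have [cC adj] := clique_cons cvC.
rewrite cprod_cons -mulgA inE; have [->|neq_uv] := eqVneq u v => /= [_|uC].
  by rewrite hd_cons hd_cprod_adj // => a /adj; rewrite e_sym.
by rewrite hd_cons_adj ?adj // IH.
Qed.

Lemma len_cprod_ge w C f z : (forall v, w v 1 = 0) -> clique C ->
  {in C, forall v, hd v z = 1} -> len w z <= len w (cprod C f * z).
Proof.
move=> w1; elim: C => [|v C IH] cvC hz; first by rewrite cprod_nil mul1g.
have [cC adj] := clique_cons cvC; rewrite cprod_cons -mulgA len_cons //.
  apply: leq_trans (leq_addl _ _); apply: IH => // u uC.
  by rewrite hz // inE uC orbT.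
rewrite hd_cprod_adj ?hz ?mem_head // => u /adj.
by rewrite e_sym.
Qed.

(** * Counting prefixes *)

Lemma prefix_of_counts k r : exists pre : {ffun V -> 'I_r.+1} -> GP,
  forall (n : {ffun V -> 'I_r.+1}) x z,
    red x z -> x * z = k -> (forall v, ncount v x = n v) ->
  pre n = x.
Proof.
apply: (@exists_fun _ _ (fun (n : {ffun V -> 'I_r.+1}) y =>
  forall x z, red x z -> x * z = k ->
  (forall v, ncount v x = n v) -> y = x)) => n.
have [[x [z [rxz xz nx]]]|no_x] := pselect (exists x z, [/\ red x z, x * z = k
  & forall v, ncount v x = n v]); last first.
  by exists 1 => x z rxz xz nx; case: no_x; exists x, z.
exists x => x' z' rxz' xz' nx'; apply: prefix_uniq rxz rxz' _ _.
  by rewrite xz.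
by move=> u; rewrite nx.
Qed.

(** The count behind all three conditions: the elements are made of a prefix [x] of
[k] with at most [r] letters at each vertex, a set of vertices [S], and for each
[v] in [S] one of [m] elements determined by the head at [v] of what remains of
[k] after [x]. *)
Lemma covered_prefixes (I : Type) (P : I -> Prop) (a : I -> GP) k r m
    (E : forall v, G v -> nat -> G v) : 0 < m ->
    (forall i, P i -> exists x z (S : {set V}) (f : forall v, G v),
      [/\ red x z, x * z = k, forall v, ncount v x <= r,
          {in S, forall v, exists2 n, n < m & E v (hd v z) n = f v} &
          a i = x * cprod (enum S) f]) ->
  covered P a (r.+1 ^ #|V| * 2 ^ #|V| * m ^ #|V|)%N.
Proof.
move=> m_gt0 decP; have [pre preP] := prefix_of_counts k r.
(* Vector of letter counts, set of vertices, and number of the element chosen at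
   each vertex; outside the set of vertices the latter is arbitrary. *)
pose J : finType := ({ffun V -> 'I_r.+1} * {set V} * {ffun V -> 'I_m})%type.
pose F (j : J) := pre j.1.1 * cprod (enum j.1.2)
  (fun v => E v (hd v ((pre j.1.1)^-1 * k)) (j.2 v)).
have -> : (r.+1 ^ #|V| * 2 ^ #|V| * m ^ #|V|)%N = #|J|.
  rewrite !card_prod !card_ffun !card_ord.
  by rewrite -[#|{set V}|]cardsT -powersetT card_powerset cardsT.
apply: (covered_fin (F := F) 1) => i /decP[x [z [S [f [rxz xz nx Ef ->]]]]].
have /fin_all_exists[phi phiP] v :
    exists n : 'I_m, v \in S -> E v (hd v z) n = f v.
  have [/Ef[n ltn <-]|] := boolP (v \in S).
    by exists (Ordinal ltn).
  by exists (Ordinal m_gt0).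
exists ([ffun v => inord (ncount v x)], S, [ffun v => phi v]).
rewrite /F /= (preP _ x z) //; last by move=> v; rewrite ffunE inordK ?ltnS.
rewrite -xz mulKg; congr (_ * _); apply: eq_cprod => v.
by rewrite mem_enum ffunE; apply: phiP.
Qed.

(** * The centroid map of a graph product *)

Section GraphCentroid.
Variables (L : forall v, G v -> nat) (c : forall v, G v -> G v -> G v) (d : nat).
Hypotheses (L_len : forall v, is_length (@L v))
  (c_cent : forall v, is_centroid (@L v) (@c v) d).

Local Notation LL := (len L).

Let L1 v : @L v 1 = 0. Proof. by have [] := L_len v. Qed.

Definition both_heads (g k : GP) : {set V} :=
  [set v | (hd v g != 1) && (hd v k != 1)].

Lemma both_heads_clique g k : clique (enum (both_heads g k)).
Proof.
split; first exact: enum_uniq.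
move=> u v; rewrite !mem_enum !inE => /andP[hu _] /andP[hv _].
exact: hd_clique hu hv.
Qed.

(** The common prefix [x] given by [common_prefix] is not specified further, so
centers are described by a relation; any choice of centers satisfies the
bounds. *)
Definition is_center (g k m : GP) := exists x g' k',
  [/\ red x g', red x k', g = x * g', k = x * k' &
      (forall v, hd v g' != 1 -> hd v g' != hd v k') /\
      m = x * cprod (enum (both_heads g' k'))
                (fun v => c (hd v g') (hd v k'))].

Lemma center_exists : exists m, forall g k, is_center g k (m g k).
Proof.
suff /boolp.choice[m mP] : forall gk : GP * GP, exists m, is_center gk.1 gk.2 m.
  by exists (fun g k => m (g, k)) => g k; apply: (mP (g, k)).
move=> [g k]; have [x [g' [k' [rg rk gE kE sep]]]] := common_prefix g k.
by eexists; exists x, g', k'; split=> //.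
Qed.

Definition gp_degree := (#|V| + #|V| + d * #|V|)%N.

Lemma gp_degreeP r : (r.+1 ^ #|V| * 2 ^ #|V| * rate d r ^ #|V|)%N <= rate gp_degree r.
Proof.
rewrite /rate /gp_degree !expnD -expnM leq_mul // leq_mul //;
by case: #|V| => // n; rewrite leq_exp2r.
Qed.

Lemma ncount_le_len v g : ncount v g <= LL g.
Proof.
apply: len_le => u s; rewrite /vertex_weight; case: (u == v) => //=.
case: eqP => //= s1; rewrite lt0n; apply/eqP => Ls.
by case: s1; have [_ /(_ _ Ls)] := L_len u.
Qed.

Lemma prefix_len_le x g : red x g -> LL x <= LL (x * g) /\ LL g <= LL (x * g).
Proof. by move=> /(len_red L1)->; rewrite leq_addr leq_addl. Qed.

Lemma center_fixed_target m k r : (forall g k, is_center g k (m g k)) ->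
  covered (fun g => LL g <= r) (m^~ k) (rate gp_degree r).
Proof.
move=> mP; apply: covered_le (gp_degreeP r) _.
have /fin_all_exists[E EP] : forall v, exists E : G v -> nat -> G v,
  forall b a, L a <= r -> exists2 n, n < rate d r & E b n = c a b.
  move=> v; apply: (@exists_fun _ _ (fun b (F : nat -> G v) => forall a,
    L a <= r -> exists2 n, n < rate d r & F n = c a b)) => b.
  exact: centers_fixed_target (c_cent v) b r.
apply: (covered_prefixes (k := k) (E := E)) (rate_gt0 d r) _ => g le_g.
have [x [g' [k' [rg rk gE kE [_ ->]]]]] := mP g k.
have [le_x le_g'] := prefix_len_le rg; rewrite -gE in le_x le_g'.
exists x, k', (both_heads g' k'), (fun v => c (hd v g') (hd v k')).
split=> // [v|v _].
  exact: leq_trans (ncount_le_len _ _) (leq_trans le_x le_g).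
apply: EP; apply: leq_trans (weight_hd_le L_len v g') _.
exact: leq_trans le_g' le_g.
Qed.

Lemma center_fixed_source m g : (forall g k, is_center g k (m g k)) ->
  covered (fun=> True) (m g) (rate gp_degree (LL g)).
Proof.
move=> mP; apply: covered_le (gp_degreeP _) _.
have /fin_all_exists[E EP] : forall v, exists E : G v -> nat -> G v,
  forall a b, exists2 n, n < rate d (L a) & E a n = c a b.
  move=> v; apply: (@exists_fun _ _ (fun a (F : nat -> G v) => forall b,
    exists2 n, n < rate d (L a) & F n = c a b)) => a.
  by have [F FP] := centers_fixed_source (c_cent v) a; exists F => b; apply: FP.
apply: (covered_prefixes (k := g) (E := E)) (rate_gt0 d _) _ => k _.
have [x [g' [k' [rg rk gE kE [_ ->]]]]] := mP g k.
have [le_x le_g'] := prefix_len_le rg; rewrite -gE in le_x le_g'.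
exists x, g', (both_heads g' k'), (fun v => c (hd v g') (hd v k')).
split=> // [v|v _]; first exact: leq_trans (ncount_le_len _ _) le_x.
have [n ltn En] := EP v (hd v g') (hd v k'); exists n => //.
apply: leq_trans ltn (rate_le _ _) => //.
exact: leq_trans (weight_hd_le L_len v g') le_g'.
Qed.

(** Only this condition depends on the third side of the triangle. Its reducedness
is that of [y^-1 * (p^-1 q z)]: a common vertex [u] of heads of [y] and of
[p^-1 q z] is not in [S], because [y] has no head there; it is therefore
adjacent to all of [S], where [p^-1 q] is nontrivial, so that [u] is a vertex
of heads of [g'] and of [k'], and belongs to [S] after all. *)
Lemma center_fixed_quotient m h r : (forall g k, is_center g k (m g k)) ->
  covered (fun g => LL g <= r) (fun g => g^-1 * m g (g * h)) (rate gp_degree r).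
Proof.
move=> mP; apply: covered_le (gp_degreeP _) _.
have /fin_all_exists[E EP] : forall v, exists E : G v -> nat -> G v,
  forall b a, L a <= r -> exists2 n, n < rate d r & E b n = a^-1 * c a (a * b).
  move=> v; apply: (@exists_fun _ _ (fun b (F : nat -> G v) => forall a,
    L a <= r -> exists2 n, n < rate d r & F n = a^-1 * c a (a * b))) => b.
  exact: centers_fixed_quotient (c_cent v) b r.
apply: (covered_prefixes (k := h) (E := E)) (rate_gt0 d r) _ => g le_g.
have [x [g' [k' [rg rk gE kE [sep ->]]]]] := mP g (g * h).
have [le_x le_g'] := prefix_len_le rg; rewrite -gE in le_x le_g'.
pose S := both_heads g' k'; have cS : clique (enum S) := both_heads_clique g' k'.
pose p v := hd v g'; pose q v := hd v k'; pose pq v := (p v)^-1 * q v.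
have S_E v : (v \in enum S) = (p v != 1) && (q v != 1) by rewrite mem_enum inE.
pose y := (cprod (enum S) p)^-1 * g'; pose z := (cprod (enum S) q)^-1 * k'.
have g'E : g' = cprod (enum S) p * y by rewrite /y mulVKg.
have k'E : k' = cprod (enum S) q * z by rewrite /z mulVKg.
have hy : {in enum S, forall v, hd v y = 1}.
  by move=> v vS; rewrite /y cprodV // hd_cprod // mulVg.
have hz : {in enum S, forall v, hd v z = 1}.
  by move=> v vS; rewrite /z cprodV // hd_cprod // mulVg.
have hpq v : v \in enum S -> hd v (cprod (enum S) pq * z) = pq v.
  by move=> vS; rewrite hd_cprod // hz // mulg1.
have k'E2 : k' = g' * (y^-1 * (cprod (enum S) pq * z)).
  rewrite [in RHS]g'E -[RHS]mulgA mulVKg [RHS]mulgA cprodM // [LHS]k'E.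
  by congr (_ * _); apply: eq_cprod => v _; rewrite mulVKg.
have hE : h = y^-1 * (cprod (enum S) pq * z).
  by apply: (@mulgI GP g); rewrite kE k'E2 mulgA -gE.
have pq1 v : v \in enum S -> pq v != 1.
  rewrite S_E => /andP[/sep pv _]; apply: contraNneq pv => /(congr1 (fun t => p v * t)).
  by rewrite /= /pq mulVKg mulg1 => qp; apply/eqP/esym.
exists y^-1, (cprod (enum S) pq * z), S, (fun v => (p v)^-1 * c (p v) (q v)).
split=> //.
- apply: red_invl => u hu; apply/eqP; apply: contraT => hu'.
  have uS : u \notin enum S by apply: contraNN hu => /hy->.
  have adj : {in enum S, forall v, e v u}.
    move=> v vS; apply: hd_clique (hu') _; first by rewrite hpq // pq1.
    by apply: contraNneq uS => <-.
  have := uS; rewrite S_E /p /q {1}g'E {1}k'E !hd_cprod_adj // hu.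
  by move: hu'; rewrite hd_cprod_adj // => ->.
- move=> v; apply: leq_trans (ncount_le_len _ _) _; rewrite (lenV L_len).
  apply: leq_trans (leq_trans le_g' le_g); rewrite [in leqRHS]g'E.
  exact: len_cprod_ge.
- move=> v; rewrite -mem_enum => vS; rewrite hpq //.
  have [] := EP v (pq v) (p v).
    exact: leq_trans (weight_hd_le L_len v g') (leq_trans le_g' le_g).
  by move=> n ltn; rewrite {2}/pq mulVKg => En; exists n.
rewrite gE invgM -!mulgA mulKg {1}g'E invgM -!mulgA; congr (_ * _).
by rewrite cprodV // cprodM.
Qed.

Lemma gp_centroid : exists c', is_centroid LL c' gp_degree.
Proof.
have [m mP] := center_exists; exists m; split=> *.
- exact: center_fixed_target.
- exact: center_fixed_source.
- exact: center_fixed_quotient.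
Qed.

End GraphCentroid.

End Pilings.

(** * Graph products of countable groups, and the theorem *)

Lemma countable_graph_product (V : finType) (e : rel V) (G : V -> groupType) :
  (forall v, countable [set: G v]%classic) ->
  countable [set: graph_product e G]%classic.
Proof.
move=> cG.
have /fin_all_exists[f f_inj] v : exists f : G v -> nat, injective f.
  have /pcard_injP[f f_inj] := cG v.
  by exists f => x y; apply: f_inj; rewrite inE.
pose code (w : seq {v : V & G v}) :=
  [seq (existT _ (tag l) (f _ (tagged l)) : {v : V & nat}) | l <- w].
have code_inj : injective code.
  apply: inj_map => -[u s] [v t] /= E; have uv : u = v := congr1 tag E.
  case: v / uv t E => t /eqP; rewrite -tag_eqE /tag_eq /= eqxx /= tagged_asE.
  by move=> /eqP/f_inj->.
apply/countable_injP.
exists (fun g : graph_product e G =>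
  pickle (code (repr (repr g : free_product G)))) => x y _ _.
move=> /(pcan_inj pickleK)/code_inj/(can_inj reprK)/(can_inj reprK).
exact.
Qed.

Theorem corollary3p25 (R : realType) (V : finType) (e : rel V)
    (e_sym : symmetric e) (e_irrefl : irreflexive e)
    (G : V -> groupType)
    (centroid_G : forall v : V, centroid_property R (G v)) :
  centroid_property R (graph_product e G).
Proof.
have /fin_all_exists[L /fin_all_exists[c /fin_all_exists[d Lcd]]] v :=
  centroid_of_property (centroid_G v).
pose D := \max_v d v.
have L_len v : is_length (L v) by have [] := Lcd v.
have c_cent v : is_centroid (L v) (c v) D.
  by have [_ /is_centroid_le] := Lcd v; apply; apply: leq_bigmax.
have [m m_cent] := gp_centroid e_sym e_irrefl L_len c_cent.
apply: property_of_centroid (len_is_length e_sym e_irrefl L_len) m_cent.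
by apply: countable_graph_product => v; have [] := centroid_G v.
Qed.
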